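(* Let $M\ge 2$. For $\mathbf R_{-1}=[R_2,\dots,R_M]\in\Re_+^{M-1}$ let $S=S(\mathbf R_{-1})\subseteq\{2,\dots,M\}$ be the maximum decodable subset of interfering users assuming that user 1's data is decoded, and define $$R_1(\mathbf R_{-1})=\min_{U\subseteq S}\Big[I(X_1,\mathbf X_U;Y_1\mid\mathbf X_{S\setminus U})-\mathbf R(U)\Big].$$ Then the function $R_1:\Re_+^{M-1}\to\Re$ is piecewise linear. More precisely, it consists of a collection of at most $3^{M-1}$ affine functions, i.e. $\Re_+^{M-1}$ is the union of at most $3^{M-1}$ polyhedral sets on each of which $R_1$ is affine.
   Context: Setting: a channel with inputs $x_i\in\mathscr X_i$, $i\in E=\{1,\dots,M\}$, output $y_1\in\mathscr Y_1$ (finite alphabets) and transition probabilities $\omega(y_1|x_1,\dots,x_M)$. User 1 is the intended user and users $2,\dots,M$ are interfering users. The input distributions $p_{X_1},\dots,p_{X_M}$ are fixed, and $(X_1,\dots,X_M,Y_1)$ has joint law $p_{X_1}(x_1)\cdots p_{X_M}(x_M)\omega(y_1|x_1,\dots,x_M)$. For $T\subseteq E$, $\mathbf X_T=(X_i)_{i\in T}$ and $\mathbf R(T)=\sum_{i\in T}R_i$. Maximum decodable subset of interfering users assuming user 1's data is decoded: a subset $S\subseteq\{2,\dots,M\}$ is decodable if $\mathbf R(T)\le I(\mathbf X_T;Y_1\mid\mathbf X_{S\setminus T},X_1)$ for all $T\subseteq S$; there is a unique decodable subset containing all others, and it is the maximum decodable subset. Piecewise linear: a function is piecewise linear if its domain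 can be represented as the union of finitely many polyhedral sets and it is affine, $\mathbf x\mapsto\mathbf a^T\mathbf x+b$, within each of these sets. A polyhedral set here means an intersection of finitely many half spaces, where the half spaces may be closed or open (strict linear inequalities allowed). *)

(* Defs.v *)
From mathcomp Require Import all_boot all_order all_algebra.
From mathcomp Require Import classical_sets reals exp.
Set Implicit Arguments.
Unset Strict Implicit.
Unset Printing Implicit Defensive.
Import Order.TTheory GRing.Theory Num.Theory.
Local Open Scope ring_scope.

Section FiniteProbability.
Variable R : realType.

Definition is_pmf (T : finType) (p : T -> R) : Prop :=
  (forall t, 0 <= p t) /\ \sum_t p t = 1.

Variables (Omega : finType) (P : Omega -> R).

Definition prob (E : pred Omega) : R := \sum_(w | E w) P w.

Definition cond_prob (E F : pred Omega) : R := prob (predI E F) / prob F.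

(* I(A; B | C) with logarithms to base [b].  Terms with
   Pr(A = u, B = v, C = z) = 0 contribute 0; if P is a pmf, the arguments
   of the logarithm and all denominators are positive in the other terms. *)
Definition cond_mutual_info (b : R) (TA TB TC : finType)
    (A : Omega -> TA) (B : Omega -> TB) (C : Omega -> TC) : R :=
  \sum_(u : TA) \sum_(v : TB) \sum_(z : TC)
    prob [pred w | [&& A w == u, B w == v & C w == z]] *
    (ln (cond_prob [pred w | (A w == u) && (B w == v)] [pred w | C w == z] /
         (cond_prob [pred w | A w == u] [pred w | C w == z] *
          cond_prob [pred w | B w == v] [pred w | C w == z])) / ln b).

End FiniteProbability.

(* The users are 'I_m.+1, so M = m.+1; the intended user 1 is ord0, and the
   interfering users 2, ..., M are lift ord0 j for j : 'I_m.  Sets of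
   interfering users are represented as {set 'I_m} and rate vectors
   [R_2, ..., R_M] as 'rV_m. *)
Section Channel.
Variables (R : realType) (b : R) (m : nat).
Variables (X : 'I_m.+1 -> finType) (Y : finType).
Variables (p : forall i, X i -> R).
Variables (omega : {dffun forall i, X i} -> Y -> R).

Definition joint_law (w : {dffun forall i, X i} * Y) : R :=
  (\prod_i p (w.1 i)) * omega w.1 w.2.

(* The random vector X_A = (X_i)_(i in A). *)
Definition inputs (A : {set 'I_m.+1}) (w : {dffun forall i, X i} * Y) :
    {dffun forall i : {i : 'I_m.+1 | i \in A}, X (val i)} :=
  [ffun i => w.1 (val i)].

Definition output (w : {dffun forall i, X i} * Y) : Y := w.2.

(* I(X_A; Y_1 | X_B) *)
Definition info (A B : {set 'I_m.+1}) : R :=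
  cond_mutual_info joint_law b (inputs A) output (inputs B).

Definition interferers (T : {set 'I_m}) : {set 'I_m.+1} := lift ord0 @: T.

Definition sum_rate (r : 'rV[R]_m) (T : {set 'I_m}) : R := \sum_(j in T) r 0 j.

Definition decodable (r : 'rV[R]_m) (S : {set 'I_m}) : bool :=
  [forall (T : {set 'I_m} | T \subset S),
    sum_rate r T <= info (interferers T) (ord0 |: interferers (S :\: T))].

Definition is_max_decodable (r : 'rV[R]_m) (S : {set 'I_m}) : bool :=
  decodable r S &&
  [forall S' : {set 'I_m}, decodable r S' ==> (S' \subset S)].

(* The unique set satisfying [is_max_decodable r]; the default value is junk
   that would only matter if there were no such set. *)
Definition max_decodable (r : 'rV[R]_m) : {set 'I_m} :=
  odflt finset.set0 [pick S | is_max_decodable r S].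

Definition rate1_bound (r : 'rV[R]_m) (S U : {set 'I_m}) : R :=
  info (ord0 |: interferers U) (interferers (S :\: U)) - sum_rate r U.

(* The minimum over all U \subset S; the seed is the term U = set0, which is
   itself in the range of the minimum. *)
Definition rate1 (r : 'rV[R]_m) : R :=
  let S := max_decodable r in
  \big[Num.min/rate1_bound r S finset.set0]_(U : {set 'I_m} | U \subset S)
    rate1_bound r S U.

End Channel.

Section PiecewiseLinear.
Local Open Scope classical_set_scope.
Variables (R : realType) (m : nat).

Definition dot (a x : 'rV[R]_m) : R := \sum_j a 0 j * x 0 j.

Definition half_space (H : set 'rV[R]_m) : Prop :=
  exists (a : 'rV[R]_m) (c : R), a != 0 /\
    (H = [set x | dot a x <= c] \/ H = [set x | dot a x < c]).

Definition polyhedral (Q : set 'rV[R]_m) : Prop :=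
  exists (k : nat) (H : 'I_k -> set 'rV[R]_m),
    (forall i, half_space (H i)) /\ Q = \bigcap_i H i.

Definition affine_on (Q : set 'rV[R]_m) (f : 'rV[R]_m -> R) : Prop :=
  exists (a : 'rV[R]_m) (c : R), forall x, Q x -> f x = dot a x + c.

Definition affine_pieces (k : nat) (D : set 'rV[R]_m) (f : 'rV[R]_m -> R) :
    Prop :=
  exists Q : 'I_k -> set 'rV[R]_m,
    (forall i, polyhedral (Q i) /\ affine_on (Q i) f) /\ D = \bigcup_i Q i.

Definition piecewise_linear (D : set 'rV[R]_m) (f : 'rV[R]_m -> R) : Prop :=
  exists k : nat, affine_pieces k D f.

Definition orthant : set 'rV[R]_m := [set x | forall j, 0 <= x 0 j].

End PiecewiseLinear.
Arguments orthant : clear implicits.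

(* Main.v *)
Require Import Defs.
From mathcomp Require Import all_boot all_order all_algebra.
From mathcomp Require Import classical_sets reals exp.
From mathcomp Require Import ring lra.
(* Gives the lemma names of finset precedence over those of classical_sets. *)
From mathcomp Require Import finset.
Set Implicit Arguments.
Unset Strict Implicit.
Unset Printing Implicit Defensive.
Import Order.TTheory GRing.Theory Num.Theory.
Local Open Scope ring_scope.

(** Put g(A) = -H(Y_1 | X_1, X_A), so that
    I(X_A; Y_1 | X_B, X_1) = g(A u B) - g(B).  As the inputs are independent,
    g is supermodular; hence so is phi(A) = g(A) - R(A).  A set S is decodable iff phi(T) <= phi(S) for all
    T included in S, and supermodularity makes the maximum decodable set the
    greatest maximizer of phi.  Being the greatest maximizer means
    phi(T) <= phi(S) for every T, strictly when T is not included in S: these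
    are linear inequalities in the rates.  Cutting this region further
    according to the minimizing U yields one polyhedral set with an affine
    rate for each of the 3^(M-1) pairs U included in S. *)

(** * Identities for finite sums and products *)

Lemma sum_setUI (V : zmodType) (T : finType) (f : T -> V) (A B : {set T}) :
  \sum_(i in A :|: B) f i + \sum_(i in A :&: B) f i =
  \sum_(i in A) f i + \sum_(i in B) f i.
Proof.
rewrite !(big_mkcond (fun i => i \in _)) /= -!big_split /=.
apply: eq_bigr => i _; rewrite !inE.
by case: (i \in A); case: (i \in B); rewrite ?addr0 ?add0r.
Qed.

(** Distributivity for factors of varying type: the inner sums are taken over the tagged union of
    the [T i], and [dffun_of_fprod] carries the resulting choice functions to dependent
    functions. *)
Lemma sum_dffun_prod (R : comPzRingType) (I : finType) (T : I -> finType)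
    (F : forall i, T i -> R) :
  \sum_(x : {dffun forall i, T i}) \prod_i F i (x i) =
  \prod_i \sum_(t : T i) F i t.
Proof.
pose G i : {ffun T i -> R} := [ffun t => F i t].
transitivity (\prod_i \sum_(t in predT : {pred T i}) G i t); last first.
  by apply: eq_bigr => i _; apply: eq_bigr => t _; rewrite ffunE.
rewrite (eq_bigr _ (fun i _ => big_tag (fun i => G i) i)).
rewrite bigA_distr_big_dep -big_fprod.
rewrite (reindex (@dffun_of_fprod I T)) /=; last first.
  exact/onW_bij/dffun_of_fprod_bij.
by apply: eq_bigr => x _; apply: eq_bigr => i _; rewrite !ffunE.
Qed.

(** * Entropy and conditional mutual information *)

Section Information.
Variables (R : realType) (Omega : finType) (P : Omega -> R).
Hypothesis P_pmf : is_pmf P.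

Let P_ge0 w : 0 <= P w. Proof. exact: P_pmf.1. Qed.

Lemma prob_ge0 (E : pred Omega) : 0 <= prob P E.
Proof. exact: sumr_ge0. Qed.

Lemma prob_fiber_gt0 (T : eqType) (A : Omega -> T) w :
  0 < P w -> 0 < prob P [pred w' | A w' == A w].
Proof.
by move=> Pw; rewrite /prob (bigD1 w) /= ?eqxx // ltr_wpDr // sumr_ge0.
Qed.

Lemma eq_prob (E F : pred Omega) : E =1 F -> prob P E = prob P F.
Proof. exact: eq_bigl. Qed.

Lemma sum_prob_fiber (T : finType) (A : Omega -> T) (E : pred Omega) :
  \sum_t prob P [pred w | (A w == t) && E w] = prob P E.
Proof.
rewrite /prob (partition_big A predT) //=; apply: eq_bigr => t _.
by apply: eq_bigl => w /=; rewrite andbC.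
Qed.

Lemma sum_prob_mul (T : finType) (A : Omega -> T) (F : T -> R) :
  \sum_t prob P [pred w | A w == t] * F t = \sum_w P w * F (A w).
Proof.
rewrite (partition_big A predT) //=; apply: eq_bigr => t _.
by rewrite big_distrl /=; apply: eq_bigr => w /eqP ->.
Qed.

(** This is -H(A) in natural units, written as an expectation over outcomes, so that it depends on
    [A] only through the partition into fibers. *)
Definition neg_entropy (T : finType) (A : Omega -> T) : R :=
  \sum_w P w * ln (prob P [pred w' | A w' == A w]).

Lemma eq_neg_entropy (T T' : finType) (A : Omega -> T) (A' : Omega -> T') :
  (forall w w', (A w == A w') = (A' w == A' w')) ->
  neg_entropy A = neg_entropy A'.
Proof.
by move=> AA'; apply: eq_bigr => w _; congr (_ * ln _); apply: eq_prob => w' /=.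
Qed.

Variables (b : R) (TA TB TC : finType).
Variables (A : Omega -> TA) (B : Omega -> TB) (C : Omega -> TC).

Let qABC w := prob P [pred w' | (A w', B w', C w') == (A w, B w, C w)].
Let qAC w := prob P [pred w' | (A w', C w') == (A w, C w)].
Let qBC w := prob P [pred w' | (B w', C w') == (B w, C w)].
Let qC w := prob P [pred w' | C w' == C w].

(** The identity I(A; B | C) = H(A, C) + H(B, C) - H(A, B, C) - H(C), checked outcome by outcome;
    outcomes of mass 0 contribute nothing, and at the others all logarithms have positive
    arguments. *)
Lemma cond_mutual_infoE : cond_mutual_info P b A B C =
  (neg_entropy (fun w => (A w, B w, C w)) + neg_entropy C
   - neg_entropy (fun w => (A w, C w)) - neg_entropy (fun w => (B w, C w)))
  / ln b.
Proof.
pose F t := ln (cond_prob P [pred w | (A w == t.1.1) && (B w == t.1.2)]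
                  [pred w | C w == t.2] /
   (cond_prob P [pred w | A w == t.1.1] [pred w | C w == t.2] *
    cond_prob P [pred w | B w == t.1.2] [pred w | C w == t.2])) / ln b.
transitivity (\sum_t prob P [pred w | (A w, B w, C w) == t] * F t).
  rewrite /cond_mutual_info pair_bigA pair_bigA /=.
  apply: eq_bigr => -[[u v] z] _ /=; congr (_ * _).
  by apply: eq_prob => w /=; rewrite !xpair_eqE andbA.
rewrite sum_prob_mul /neg_entropy -big_split -!sumrB mulr_suml.
apply: eq_bigr => w _; rewrite /F /=.
have [Pw|Pw] := ltP 0 (P w); last first.
  by have -> : P w = 0 by [apply/eqP; rewrite eq_le Pw P_ge0]; rewrite !mul0r; ring.
have ABC0 : 0 < qABC w := (prob_fiber_gt0 (fun w => (A w, B w, C w)) Pw).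
have AC0 : 0 < qAC w := (prob_fiber_gt0 (fun w => (A w, C w)) Pw).
have BC0 : 0 < qBC w := (prob_fiber_gt0 (fun w => (B w, C w)) Pw).
have C0 : 0 < qC w := (prob_fiber_gt0 C Pw).
rewrite /cond_prob mulrA -!mulrDr -!mulrBr; congr (_ * _ / _).
have -> : prob P (predI [pred w0 | (A w0 == A w) && (B w0 == B w)]
      [pred w0 | C w0 == C w]) = qABC w.
  by apply: eq_prob => w' /=; rewrite !xpair_eqE.
have -> : prob P (predI [pred w0 | A w0 == A w] [pred w0 | C w0 == C w]) = qAC w.
  by apply: eq_prob => w' /=; rewrite !xpair_eqE.
have -> : prob P (predI [pred w0 | B w0 == B w] [pred w0 | C w0 == C w]) = qBC w.
  by apply: eq_prob => w' /=; rewrite !xpair_eqE.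
rewrite -/(qABC w) -/(qAC w) -/(qBC w) -/(qC w).
rewrite !(ln_div, lnM) ?posrE ?mulr_gt0 ?divr_gt0 ?invr_gt0 //; ring.
Qed.

(* ln t <= t - 1 bounds the negated information by the total mass, minus 1, of
   the law p(a, c) p(b, c) / p(c). *)
Lemma cond_mutual_info_ge0 : 1 < b -> 0 <= cond_mutual_info P b A B C.
Proof.
move=> b1; rewrite cond_mutual_infoE.
apply: divr_ge0; last exact: ln_ge0 (ltW b1).
rewrite -oppr_le0.
pose r w := qAC w * qBC w / (qABC w * qC w).
have -> : - (neg_entropy (fun w => (A w, B w, C w)) + neg_entropy C
   - neg_entropy (fun w => (A w, C w)) - neg_entropy (fun w => (B w, C w)))
   = \sum_w P w * (ln (qAC w) + ln (qBC w) - ln (qABC w) - ln (qC w)).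
  rewrite /neg_entropy -big_split -!sumrB -sumrN; apply: eq_bigr => w _ /=.
  rewrite /qABC /qAC /qBC /qC; ring.
apply: (@le_trans _ _ (\sum_w (P w * r w - P w))).
  apply: ler_sum => w _.
  have [Pw|Pw] := ltP 0 (P w); last first.
    by have -> : P w = 0 by [apply/eqP; rewrite eq_le Pw P_ge0]; rewrite !mul0r subr0.
  have ABC0 : 0 < qABC w := (prob_fiber_gt0 (fun w => (A w, B w, C w)) Pw).
  have AC0 : 0 < qAC w := (prob_fiber_gt0 (fun w => (A w, C w)) Pw).
  have BC0 : 0 < qBC w := (prob_fiber_gt0 (fun w => (B w, C w)) Pw).
  have C0 : 0 < qC w := (prob_fiber_gt0 C Pw).
  have r0 : 0 < r w by rewrite divr_gt0 ?mulr_gt0.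
  have -> : ln (qAC w) + ln (qBC w) - ln (qABC w) - ln (qC w) = ln (r w).
    rewrite !(ln_div, lnM) ?posrE ?mulr_gt0 ?invr_gt0 //; ring.
  rewrite -{3}[P w]mulr1 -mulrBr ler_pM2l //.
  by rewrite -{1}[r w](addrNK 1) addrC le_ln1Dx // ltrBrDr addNr.
rewrite sumrB P_pmf.2 subr_le0.
pose pABC t := prob P [pred w | (A w, B w, C w) == t].
pose pAC u z := prob P [pred w | (A w == u) && (C w == z)].
pose pBC v z := prob P [pred w | (B w == v) && (C w == z)].
pose pC z := prob P [pred w | C w == z].
pose s t := pAC t.1.1 t.2 * pBC t.1.2 t.2 / (pABC t * pC t.2).
have -> : \sum_w P w * r w = \sum_t pABC t * s t.
  by rewrite sum_prob_mul; apply: eq_bigr=> w _.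
(* Only an inequality: cancelling [pABC t] loses the terms where it vanishes, and these are
   nonnegative on the right. *)
apply: (@le_trans _ _ (\sum_t pAC t.1.1 t.2 * pBC t.1.2 t.2 / pC t.2)).
  apply: ler_sum => -[[u v] z] _; rewrite /s /=.
  have [->|p0] := eqVneq (pABC (u, v, z)) 0.
    by rewrite mul0r divr_ge0 ?mulr_ge0 ?prob_ge0.
  by rewrite invfM mulrCA mulVKf.
rewrite -(pair_bigA _ (fun t z => pAC t.1 z * pBC t.2 z / pC z)) /= exchange_big /=.
have -> : 1 = \sum_z pC z.
  by rewrite -P_pmf.2 (partition_big C predT).
apply: ler_sum => z _.
rewrite -mulr_suml -(pair_bigA _ (fun u v => pAC u z * pBC v z)) /=.
under eq_bigr do rewrite -mulr_sumr.
rewrite -mulr_suml !sum_prob_fiber -[X in X * X]/(pC z).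
(* The sum over u and v is [pC z * pC z / pC z], which is [pC z] even when that is 0. *)
by have [->|p0] := eqVneq (pC z) 0; rewrite ?mul0r // mulfK.
Qed.

End Information.

(** * Channel law, independence of the inputs, supermodularity of -H(Y_1 | X_A) *)

Section Channel.
Variables (R : realType) (b : R) (m : nat).
Variables (X : 'I_m.+1 -> finType) (Y : finType).
Variables (p : forall i, X i -> R).
Variables (omega : {dffun forall i, X i} -> Y -> R).
Hypothesis b_gt1 : 1 < b.
Hypothesis p_pmf : forall i, is_pmf (@p i).
Hypothesis omega_pmf : forall x, is_pmf (omega x).

Local Notation Omega := ({dffun forall i, X i} * Y)%type.
Local Notation P := (joint_law (@p) omega).
Local Notation inputs := (@inputs m X Y).
Local Notation output := (@output m X Y).

Lemma inputs_eqE (A : {set 'I_m.+1}) (w w' : Omega) :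
  (inputs A w == inputs A w') = [forall i in A, w.1 i == w'.1 i].
Proof.
apply/eqP/forall_inP => [eqA i iA|eqA].
  by move/ffunP: eqA => /(_ (exist _ i iA)); rewrite !ffunE /= => ->.
by apply/ffunP => -[i iA]; rewrite !ffunE /=; apply/eqP/eqA.
Qed.

Lemma inputsU_eqE (A B : {set 'I_m.+1}) (w w' : Omega) :
  (inputs (A :|: B) w == inputs (A :|: B) w') =
  (inputs A w == inputs A w') && (inputs B w == inputs B w').
Proof.
rewrite !inputs_eqE; apply/forall_inP/andP => [eqAB|[/forall_inP eqA /forall_inP eqB] i].
  by split; apply/forall_inP => i iAB; apply: eqAB; rewrite inE iAB ?orbT.
by rewrite inE => /orP[/eqA|/eqB].
Qed.

Lemma inputs_eqW (A B : {set 'I_m.+1}) (w w' : Omega) : A \subset B ->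
  inputs B w == inputs B w' -> inputs A w == inputs A w'.
Proof. by move=> /setUidPr <-; rewrite inputsU_eqE => /andP[]. Qed.

(** Independence of the inputs: the event is absorbed into the factors [F i], so the sum factorizes;
    the output and the coordinates outside [A] each sum to 1. *)
Lemma prob_inputs (A : {set 'I_m.+1}) (x : {dffun forall i, X i}) :
  prob P [pred w : Omega | [forall i in A, w.1 i == x i]] = \prod_(i in A) p (x i).
Proof.
pose F i t : R := if (i \in A) ==> (t == x i) then p t else 0.
transitivity (\prod_i \sum_(t : X i) F i t); last first.
  rewrite [RHS]big_mkcond /=; apply: eq_bigr => i _; rewrite /F.
  case: (i \in A) => /=; last exact: (p_pmf i).2.
  by rewrite -big_mkcond big_pred1_eq.
rewrite -sum_dffun_prod /prob big_mkcond /=.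
rewrite -(pair_bigA _ (fun (x' : {dffun forall i, X i})  y =>
  if [forall i in A, x' i == x i] then joint_law (@p) omega (x', y) else 0)) /=.
apply: eq_bigr => x' _; case: (boolP [forall i in A, _]) => [/forall_inP eqx|].
  rewrite /joint_law /= -mulr_sumr (omega_pmf x').2 mulr1.
  by apply: eq_bigr => i _; rewrite /F; case: ifP => // /negP[]; apply/implyP/eqx.
rewrite negb_forall_in => /exists_inP[i iA neq].
by rewrite big1 // (bigD1 i) //= /F iA (negbTE neq) mul0r.
Qed.

Lemma joint_law_pmf : is_pmf P.
Proof.
split=> [[x y]|].
  rewrite mulr_ge0 ?(omega_pmf x).1 // prodr_ge0 // => i _.
  exact: (p_pmf i).1.
have <- : \prod_i \sum_t @p i t = 1.
  by apply: big1 => i _; apply: (p_pmf i).2.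
rewrite -sum_dffun_prod.
rewrite -(pair_bigA _ (fun x y => joint_law (@p) omega (x, y))) /=.
by apply: eq_bigr => x _; rewrite /joint_law /= -mulr_sumr (omega_pmf x).2 mulr1.
Qed.

(** Independence turns the logarithm of the joint probability into a sum, so the entropy of the
    inputs is a modular function of [A]. *)
Lemma neg_entropy_inputs (A : {set 'I_m.+1}) :
  neg_entropy P (inputs A) = \sum_(i in A) \sum_w P w * ln (p (w.1 i)).
Proof.
rewrite exchange_big; apply: eq_bigr => -[x y] _ /=; rewrite -mulr_sumr.
rewrite (@eq_prob _ _ _ _ [pred w : Omega | [forall i in A, w.1 i == x i]]); last first.
  by move=> w /=; rewrite inputs_eqE.
rewrite prob_inputs.
(* Off the outcomes of mass 0 every factor is positive, as the logarithm of the product requires. *)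
have [->|P0] := eqVneq (P (x, y)) 0; first by rewrite !mul0r.
have p0 i : 0 < p (x i).
  rewrite lt_neqAle (p_pmf i).1 andbT eq_sym; apply: contra P0 => /eqP pi0.
  by rewrite /joint_law /= (bigD1 i) //= pi0 !mul0r.
congr (_ * _); rewrite -!big_enum /=.
elim: (enum A) => [|i s IH]; first by rewrite !big_nil ln1.
by rewrite !big_cons lnM ?posrE ?prodr_gt0 ?IH // => j _.
Qed.

(* -H(Y_1 | X_A) with logarithms to base b. *)
Definition info_potential (A : {set 'I_m.+1}) : R :=
  (neg_entropy P (fun w => (inputs A w, output w)) - neg_entropy P (inputs A))
  / ln b.

(** The chain rule I(X_A; Y_1 | X_B) = H(Y_1 | X_B) - H(Y_1 | X_A, X_B). *)
Lemma infoE (A B : {set 'I_m.+1}) :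
  info b (@p) omega A B = info_potential (A :|: B) - info_potential B.
Proof.
rewrite /info (cond_mutual_infoE joint_law_pmf) /info_potential -mulrBl.
congr (_ / _).
rewrite (@eq_neg_entropy _ _ _ _ _ _ (fun w => (inputs (A :|: B) w, output w))).
rewrite (@eq_neg_entropy _ _ _ _ _ (fun w => (inputs A w, inputs B w))
                           (inputs (A :|: B))).
rewrite (@eq_neg_entropy _ _ _ _ _ (fun w => (output w, inputs B w))
                           (fun w => (inputs B w, output w))).
- ring.
- by move=> w w'; rewrite !xpair_eqE andbC.
- by move=> w w'; rewrite xpair_eqE inputsU_eqE.
- by move=> w w'; rewrite !xpair_eqE inputsU_eqE andbAC.
Qed.

(* The defect of supermodularity is I(X_A; X_B | X_(A :&: B), Y): the terms
   without output cancel, the inputs being independent. *)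
Lemma info_potential_supermodular (A B : {set 'I_m.+1}) :
  info_potential A + info_potential B <=
  info_potential (A :|: B) + info_potential (A :&: B).
Proof.
have := cond_mutual_info_ge0 joint_law_pmf (inputs A) (inputs B)
  (fun w => (inputs (A :&: B) w, output w)) b_gt1.
rewrite (cond_mutual_infoE joint_law_pmf).
(* X_(A :&: B) is determined by X_A, and also by X_B, so it drops out of every joint entropy
   containing one of them. *)
have sIA := subsetIl A B; have sIB := subsetIr A B.
rewrite (@eq_neg_entropy _ _ _ _ _ _
  (fun w => (inputs (A :|: B) w, output w))); last first.
  move=> w w'; rewrite !xpair_eqE inputsU_eqE.
  by case eA: (inputs A w == _); rewrite //= (inputs_eqW sIA eA).
rewrite (@eq_neg_entropy _ _ _ _ _ (fun w => (inputs A w, _))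
                           (fun w => (inputs A w, output w))); last first.
  move=> w w'; rewrite !xpair_eqE.
  by case eA: (inputs A w == _); rewrite //= (inputs_eqW sIA eA).
rewrite (@eq_neg_entropy _ _ _ _ _ (fun w => (inputs B w, _))
                           (fun w => (inputs B w, output w))); last first.
  move=> w w'; rewrite !xpair_eqE.
  by case eB: (inputs B w == _); rewrite //= (inputs_eqW sIB eB).
move=> /le_trans h; rewrite -subr_ge0; apply: h; rewrite le_eqVlt; apply/orP; left.
have := sum_setUI (fun i => \sum_w P w * ln (p (w.1 i))) A B.
rewrite -!neg_entropy_inputs /info_potential -!mulrDl -mulrBl => mod.
by apply/eqP; congr (_ / _); lra.
Qed.

(** The function g of the overview, with logarithms to base [b]. *)
Definition interferer_potential (T : {set 'I_m}) : R :=
  info_potential (ord0 |: interferers T).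

Lemma interferer_potential_supermodular (S T : {set 'I_m}) :
  interferer_potential S + interferer_potential T <=
  interferer_potential (S :|: T) + interferer_potential (S :&: T).
Proof.
apply: le_trans (info_potential_supermodular _ _) _.
rewrite -setUUr -setUIr /interferer_potential /interferers imsetU.
by rewrite imsetI // => i j _ _; apply: lift_inj.
Qed.

(** * Decodable sets as maximizers of a supermodular function *)

(** The function phi of the overview. *)
Definition slack (r : 'rV[R]_m) (T : {set 'I_m}) : R :=
  interferer_potential T - sum_rate r T.

Lemma slack_supermodular (r : 'rV[R]_m) (S T : {set 'I_m}) :
  slack r S + slack r T <= slack r (S :|: T) + slack r (S :&: T).
Proof.
have := interferer_potential_supermodular S T.
have := sum_setUI (fun j => r 0 j) S T.
rewrite /slack /sum_rate; lra.
Qed.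

Lemma sum_rateD (r : 'rV[R]_m) (S T : {set 'I_m}) : T \subset S ->
  sum_rate r (S :\: T) = sum_rate r S - sum_rate r T.
Proof.
move=> /setIidPr TS; rewrite /sum_rate [X in _ = X - _](big_setID T) /= TS; ring.
Qed.

(** By the chain rule the constraint of [T] reads [slack r (S :\: T) <= slack r S], and
    complementation in [S] permutes the subsets of [S]. *)
Lemma decodableP (r : 'rV[R]_m) (S : {set 'I_m}) :
  reflect (forall T : {set 'I_m}, T \subset S -> slack r T <= slack r S)
          (decodable b (@p) omega r S).
Proof.
have equiv (T : {set 'I_m}) : T \subset S ->
    (sum_rate r T <=
       info b (@p) omega (interferers T) (ord0 |: interferers (S :\: T))) =
    (slack r (S :\: T) <= slack r S).
  move=> TS; have eS : T :|: S :\: T = S by rewrite -{1}(setIidPr TS) setID.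
  rewrite infoE setUCA /interferers -imsetU eS.
  rewrite /slack sum_rateD // /interferer_potential /interferers.
  by apply/idP/idP; lra.
apply: (iffP forall_inP) => [decS T TS|maxS T TS]; last first.
  by rewrite equiv // maxS // subsetDl.
have DT : S :\: (S :\: T) = T by rewrite setDDr setDv set0U; apply/setIidPr.
by have := decS _ (subsetDl S T); rewrite equiv ?subsetDl // DT.
Qed.

Lemma is_max_decodable_uniq (r : 'rV[R]_m) (S : {set 'I_m}) :
  is_max_decodable b (@p) omega r S -> max_decodable b (@p) omega r = S.
Proof.
move=> /andP[dS /forallP maxS]; rewrite /max_decodable; case: pickP => [S'|/(_ S)].
  move=> /andP[dS' /forallP maxS'] /=; apply/eqP; rewrite eqEsubset.
  by rewrite (implyP (maxS _)) // (implyP (maxS' _)).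
by rewrite /is_max_decodable dS; move/negP; case; apply/forallP.
Qed.

Definition greatest_maximizer (r : 'rV[R]_m) (S : {set 'I_m}) : Prop :=
  forall T : {set 'I_m}, if T \subset S then slack r T <= slack r S
                           else slack r T < slack r S.

(** If [T] is decodable, then [slack r (T :&: S) <= slack r T], so supermodularity gives
    [slack r S <= slack r (T :|: S)]. This contradicts strictness unless [T] lies in [S]. *)
Lemma greatest_maximizer_decodable (r : 'rV[R]_m) (S : {set 'I_m}) :
  greatest_maximizer r S -> max_decodable b (@p) omega r = S.
Proof.
move=> maxS; apply: is_max_decodable_uniq; apply/andP; split.
  by apply/decodableP => T TS; have := maxS T; rewrite TS.
apply/forallP => T; apply/implyP => /decodableP decT.
have := maxS (T :|: S); case: ifP => [|_ lt_TS]; first by rewrite subUset => /andP[].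
have := decT (T :&: S) (subsetIl _ _); have := slack_supermodular r T S; lra.
Qed.

(** A maximizer of largest cardinality works: by supermodularity its union with any other maximizer
    is again a maximizer, hence no larger. *)
Lemma greatest_maximizer_exists (r : 'rV[R]_m) :
  exists S, greatest_maximizer r S.
Proof.
pose maxi (S : {set 'I_m}) := [forall T, slack r T <= slack r S].
have [S0 maxS0] : exists S0, maxi S0.
  exists [arg max_(S > finset.set0) slack r S]%O; case: arg_maxP => // S _ maxS.
  by apply/forallP => T; apply: maxS.
have [S /forallP maxS cardS] := arg_maxnP (fun S : {set 'I_m} => #|S|) maxS0.
exists S => T; case: ifP => // /negbT TS; rewrite ltNge; apply: contra TS => leST.
have maxU : maxi (S :|: T).
  apply/forallP => V; have := slack_supermodular r S T.
  have := maxS (S :&: T); have := maxS V; lra.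
have /eqP -> : S == S :|: T by rewrite eqEcard subsetUl; apply: cardS.
exact: subsetUr.
Qed.

End Channel.

(** * Polyhedral sets cut out by rate inequalities *)

Section Polyhedra.
Variables (R : realType) (m : nat).
Local Open Scope classical_set_scope.

(** The empty intersection. It covers conditions true for all rates, which are not half spaces
    because a half space has a nonzero normal. *)
Lemma polyhedralT : polyhedral [set: 'rV[R]_m]%classic.
Proof.
exists 0, (fun=> classical_sets.setT); split; first by case.
by apply/esym; rewrite -classical_sets.subTset => x _ [].
Qed.

Lemma polyhedral_half_space (H : set 'rV[R]_m) : half_space H -> polyhedral H.
Proof.
by move=> hH; exists 1, (fun=> H); split => //; rewrite bigcap_const //; exists ord0.
Qed.

Lemma polyhedralI (Q1 Q2 : set 'rV[R]_m) :
  polyhedral Q1 -> polyhedral Q2 -> polyhedral (Q1 `&` Q2).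
Proof.
move=> [k1 [H1 [hH1 ->]]] [k2 [H2 [hH2 ->]]].
exists (k1 + k2)%N, (fun i => match split i with inl j => H1 j | inr j => H2 j end).
split=> [i|]; first by case: (split i).
apply/seteqP; split=> x.
  by move=> [Hx1 Hx2] i _; case: (split i) => j; [apply: Hx1|apply: Hx2].
move=> Hx; split=> j _.
  by have := Hx (unsplit (inl j)) I; rewrite unsplitK.
by have := Hx (unsplit (inr j)) I; rewrite unsplitK.
Qed.

Lemma polyhedral_forall (T : finType) (H : T -> set 'rV[R]_m) :
  (forall t, polyhedral (H t)) -> polyhedral [set x | forall t, H t x].
Proof.
move=> hH.
have -> : [set x | forall t, H t x] = [set x | forall t, t \in enum T -> H t x].
  by apply/seteqP; split=> x Hx t => [_|]; apply: Hx; rewrite ?mem_enum.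
elim: (enum T) => [|t s IH].
  by have -> : [set x | forall t, t \in [::] -> H t x] = classical_sets.setT by
    [rewrite -classical_sets.subTset]; exact: polyhedralT.
have -> : [set x | forall t', t' \in t :: s -> H t' x] =
    H t `&` [set x | forall t', t' \in s -> H t' x].
  apply/seteqP; split=> x.
    move=> Hx; split=> [|t' ts]; apply: Hx; rewrite inE ?eqxx ?ts ?orbT //.
  by move=> [Ht Hs] t'; rewrite inE => /orP[/eqP ->|/Hs].
exact: polyhedralI.
Qed.

Definition indicator (T : {set 'I_m}) : 'rV[R]_m := \row_j (j \in T)%:R.

Lemma dot_indicator (T : {set 'I_m}) (r : 'rV[R]_m) :
  dot (indicator T) r = sum_rate r T.
Proof.
rewrite /dot /sum_rate [RHS]big_mkcond /=; apply: eq_bigr => j _.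
by rewrite mxE; case: (j \in T); rewrite ?mul1r ?mul0r.
Qed.

Lemma dotNl (a r : 'rV[R]_m) : dot (- a) r = - dot a r.
Proof.
by rewrite /dot -sumrN; apply: eq_bigr => j _; rewrite mxE mulNr.
Qed.

Lemma dotBl (a a' r : 'rV[R]_m) : dot (a - a') r = dot a r - dot a' r.
Proof.
by rewrite /dot -sumrB; apply: eq_bigr => j _; rewrite !mxE mulrBl.
Qed.

(** With the rates on one side the normal is [indicator S - indicator T], nonzero because the sets
    differ, and the bound is [c S - c T]. *)
Lemma polyhedral_rate_le_lt (c : {set 'I_m} -> R) (S T : {set 'I_m}) : S != T ->
  polyhedral [set r | c T - sum_rate r T <= c S - sum_rate r S] /\
  polyhedral [set r | c T - sum_rate r T < c S - sum_rate r S].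
Proof.
move=> neqST.
have a0 : indicator S - indicator T != 0.
  rewrite subr_eq0; apply: contra neqST => /eqP /rowP eqST; apply/eqP/setP => j.
  by have /eqP := eqST j; rewrite !mxE eqr_nat; do 2!case: (j \in _).
split; apply: polyhedral_half_space; exists (indicator S - indicator T), (c S - c T);
  split=> //; [left|right]; apply/seteqP;
  by split=> r /=; rewrite dotBl !dot_indicator; lra.
Qed.

Lemma polyhedral_rate_le (c : {set 'I_m} -> R) (S T : {set 'I_m}) :
  polyhedral [set r | c T - sum_rate r T <= c S - sum_rate r S].
Proof.
have [<-|/(polyhedral_rate_le_lt c) []//] := eqVneq S T.
have -> : [set r | c S - sum_rate r S <= c S - sum_rate r S] = classical_sets.setT.
  by rewrite -classical_sets.subTset => r _ /=.
exact: polyhedralT.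
Qed.

Lemma polyhedral_rate_lt (c : {set 'I_m} -> R) (S T : {set 'I_m}) : S != T ->
  polyhedral [set r | c T - sum_rate r T < c S - sum_rate r S].
Proof. by move=> /(polyhedral_rate_le_lt c) []. Qed.

Lemma polyhedral_orthant : polyhedral (orthant R m).
Proof.
apply: (@polyhedral_forall 'I_m (fun j => [set r : 'rV[R]_m | 0 <= r 0 j])) => j.
apply: polyhedral_half_space; exists (- indicator [set j]%SET), 0; split.
  rewrite oppr_eq0; apply/eqP => /rowP /(_ j) /eqP.
  by rewrite !mxE inE eqxx oner_eq0.
left; apply/seteqP; split=> r /=;
  by rewrite dotNl dot_indicator /sum_rate big_set1 oppr_le0.
Qed.

End Polyhedra.

(** * The regions and their number *)

Theorem theorem4 (R : realType) (b : R) (m : nat)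
    (X : 'I_m.+1 -> finType) (Y : finType)
    (p : forall i : 'I_m.+1, X i -> R)
    (omega : {dffun forall i : 'I_m.+1, X i} -> Y -> R) :
  1 < b ->
  (2 <= m.+1)%N ->
  (forall i : 'I_m.+1, is_pmf (p i)) ->
  (forall x : {dffun forall i : 'I_m.+1, X i}, is_pmf (omega x)) ->
  piecewise_linear (orthant R m) (rate1 b p omega) /\
  exists2 k : nat, (k <= 3 ^ m)%N &
    affine_pieces k (orthant R m) (rate1 b p omega).
Proof.
move=> b1 _ p_pmf omega_pmf.
(* The family has exactly [3 ^ m] regions, some possibly empty, and gives both claims. *)
suff pieces : affine_pieces (3 ^ m) (orthant R m) (rate1 b p omega).
  by split; exists (3 ^ m)%N.
pose best (S : {set 'I_m}) := [set r | greatest_maximizer b p omega r S]%classic.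
pose least (S U : {set 'I_m}) := [set r | forall V : {set 'I_m}, V \subset S ->
  rate1_bound b p omega r S U <= rate1_bound b p omega r S V]%classic.
pose region S U := (orthant R m `&` (best S `&` least S U))%classic.
have polyhedral_region S U : polyhedral (region S U).
  apply: polyhedralI; first exact: polyhedral_orthant.
  apply: polyhedralI; apply: polyhedral_forall => T.
    have [TS|TS] := boolP (T \subset S); first exact: polyhedral_rate_le.
    by apply: polyhedral_rate_lt; apply: contraNneq TS => ->.
  have [TS|TS] := boolP (T \subset S); last first.
    rewrite (_ : (fun=> _) = classical_sets.setT); first exact: polyhedralT.
    by rewrite -classical_sets.subTset.
  rewrite (_ : (fun r => _) = [set r |
    rate1_bound b p omega r S U <= rate1_bound b p omega r S T]%classic).
    (* For fixed [S] the information term depends on the set alone, so it serves as [c]. *)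
    exact: (polyhedral_rate_le
      (fun V => info b p omega (ord0 |: interferers V) (interferers (S :\: V)))).
  by apply/classical_sets.seteqP; split=> r; [apply|].
have rate1_region (S U : {set 'I_m}) r : U \subset S -> region S U r ->
    rate1 b p omega r = rate1_bound b p omega r S U.
  move=> US [_ [bestS leastU]].
  rewrite /rate1 (greatest_maximizer_decodable b1 p_pmf omega_pmf bestS).
  apply/eqP; rewrite eq_le bigmin_le_cond //=.
  (* The seed is the term of the empty set, a subset of [S], so [leastU] bounds it too. *)
  by apply: le_bigmin => [|V]; apply: leastU; rewrite ?sub0set.
(* A pair U \subset S is coded by its map to {0, 1, 2}, with 2 on U and 1 on
   S :\: U. *)
pose outer (f : {ffun 'I_m -> 'I_3}) := [set j | f j != ord0].
pose inner (f : {ffun 'I_m -> 'I_3}) := [set j | f j == ord_max].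
have inner_outer f : inner f \subset outer f.
  by apply/fintype.subsetP => j; rewrite !inE => /eqP ->.
have card_codes : #|{ffun 'I_m -> 'I_3}| = (3 ^ m)%N.
  by rewrite card_ffun !card_ord.
(* The number of pieces becomes the cardinal of the codes, so that [enum_val] decodes an index. *)
rewrite -card_codes.
exists (fun i => region (outer (enum_val i)) (inner (enum_val i))); split.
  move=> i; split; first exact: polyhedral_region.
  move: (enum_val i) => f.
  exists (- indicator R (inner f)), (info b p omega (ord0 |: interferers (inner f))
     (interferers (outer f :\: inner f))).
  move=> r /(rate1_region _ _ _ (inner_outer f)) ->.
  by rewrite /rate1_bound addrC dotNl dot_indicator.
apply/classical_sets.seteqP; split=> r; last by move=> [i _ []].
(* Covering: [r] lies in the region of its greatest maximizer [S] and of a [U] attaining the minimum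
   over the subsets of [S]. *)
move=> r0; have [S bestS] := greatest_maximizer_exists b1 p_pmf omega_pmf r.
pose U := [arg min_(V < S | V \subset S) rate1_bound b p omega r S V]%O.
have [US leastU] : U \subset S /\ least S U r.
  by rewrite /U; case: arg_minP => // V VS minV; split.
pose f : {ffun 'I_m -> 'I_3} :=
  [ffun j => if j \in U then ord_max else if j \in S then inord 1 else ord0].
have eU : inner f = U.
  apply/setP => j; rewrite inE ffunE; case: ifP => // _.
  by case: ifP => _; rewrite -val_eqE /= ?inordK.
have eS : outer f = S.
  apply/setP => j; rewrite inE ffunE; case: ifP => [/(fintype.subsetP US) ->//|_].
  by case: ifP => _; rewrite -val_eqE /= ?inordK.
by exists (enum_rank f) => //; rewrite enum_rankK eU eS.
Qed.
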